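(* Let $\mathbb{H}^2$ be the real hyperbolic plane, let $T_3$ be the infinite $3$-regular tree, and let $Z$ be a bounded degree graph with polynomial growth. Then there is no regular map $\mathbb{H}^2\to T_3\times Z$.
   Context: A map $f:X\to Y$ between metric spaces is regular if there is $\kappa$ such that (i) $d_Y(f(x),f(x'))\leq \kappa(1+d_X(x,x'))$ for all $x,x'\in X$, and (ii) the preimage of every open ball of radius $1$ in $Y$ is contained in a union of at most $\kappa$ balls of radius $1$ in $X$. Graphs carry their shortest path metric; $T_3\times Z$ carries a product metric (e.g. $\ell^1$). A bounded degree graph $Z$ has polynomial growth if there are $C,d>0$ with $|B(z,r)|\leq Cr^d+C$ for all vertices $z$ and $r\geq 0$. *)

(* Defs.v *)
From Stdlib Require Import Reals Lra List ClassicalEpsilon.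
Open Scope R_scope.

Definition regular {X Y : Type} (dX : X -> X -> R) (dY : Y -> Y -> R)
  (f : X -> Y) : Prop :=
  exists kappa : R,
    (forall x x' : X, dY (f x) (f x') <= kappa * (1 + dX x x')) /\
    (forall y : Y, exists centers : list X,
        INR (length centers) <= kappa /\
        forall x : X, dY (f x) y < 1 ->
          exists c, In c centers /\ dX x c < 1).

Definition H2 : Type := { p : R * R | 0 < snd p }.

Definition arcosh (t : R) : R := ln (t + sqrt (t * t - 1)).

Definition hyp_dist (p q : H2) : R :=
  let (x1, y1) := proj1_sig p in
  let (x2, y2) := proj1_sig q in
  arcosh (1 + ((x1 - x2) ^ 2 + (y1 - y2) ^ 2) / (2 * y1 * y2)).

Inductive walk {V : Type} (adj : V -> V -> Prop) : V -> V -> nat -> Prop :=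
| walk0 : forall v, walk adj v v 0
| walkS : forall u w v n, adj u w -> walk adj w v n -> walk adj u v (S n).

(* the length of a shortest walk (meaningful for connected graphs) *)
Definition graph_dist {V : Type} (adj : V -> V -> Prop) (u v : V) : R :=
  INR (epsilon (inhabits 0%nat)
         (fun n => walk adj u v n /\ forall m, walk adj u v m -> (n <= m)%nat)).

Definition symmetric_rel {V : Type} (adj : V -> V -> Prop) : Prop :=
  forall u v, adj u v -> adj v u.

Definition connected_graph {V : Type} (adj : V -> V -> Prop) : Prop :=
  forall u v, exists n, walk adj u v n.

Definition bounded_degree {V : Type} (adj : V -> V -> Prop) : Prop :=
  exists D : nat, forall v, exists nbrs : list V,
      (length nbrs <= D)%nat /\ forall w, adj v w -> In w nbrs.

(* |B(z,r)| <= C r^d + C for all vertices z and radii r > 0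
   (the case r = 0 follows from small r > 0, since B(z,r) = {z} for r < 1). *)
Definition polynomial_growth {V : Type} (adj : V -> V -> Prop) : Prop :=
  exists C d : R, 0 < C /\ 0 < d /\
    forall (z : V) (r : R), 0 < r ->
      exists ball : list V,
        INR (length ball) <= C * Rpower r d + C /\
        forall w, graph_dist adj z w <= r -> In w ball.

(* vertices: reduced words over {0,1,2} (no two consecutive equal letters);
   edges: w -- a :: w.  The root has 3 neighbours, every other vertex 3. *)
Fixpoint reducedb (w : list nat) : bool :=
  match w with
  | nil => true
  | a :: w' =>
      Nat.ltb a 3 &&
      match w' with nil => true | b :: _ => negb (Nat.eqb a b) end &&
      reducedb w'
  end.

Definition T3 : Type := { w : list nat | reducedb w = true }.

Definition T3_adj (u v : T3) : Prop :=
  (exists a, proj1_sig v = a :: proj1_sig u) \/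
  (exists a, proj1_sig u = a :: proj1_sig v).

Definition T3_dist : T3 -> T3 -> R := graph_dist T3_adj.

Definition prod_dist {A B : Type} (dA : A -> A -> R) (dB : B -> B -> R)
  (p q : A * B) : R := dA (fst p) (fst q) + dB (snd p) (snd q).

(* Main.v *)
Require Import Defs.
From Stdlib Require Import Reals.
From Stdlib Require Import Lra Lia List Arith Bool.
From Stdlib Require Import Classical ClassicalEpsilon Eqdep_dec.
Import ListNotations.
Local Open Scope nat_scope.

(* Restrict a regular map to the binary tiling of the half plane and let [g]
   be its tree coordinate. Polynomial growth of [Z] and regularity make the
   number of [s]-th generation descendants of a node with [g] near a given
   tree vertex polynomial in [s], against [2^s] descendants in total. Hence,
   if [g x] lies far from the gate of a branch of the tree, almost all
   descendants of [x] stay on the side of [x].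

   Fix a tree vertex [v] and the branches at a large distance [r] from it. If
   [g x] is near [v], no branch captures most descendants of [x]; conversely,
   a pair of adjacent nodes, no branch of which captures most descendants,
   must be mapped near [v]. Such pairs can be refined indefinitely, which
   gives a descending chain near [v]; the other children along the chain are
   near [v] too and start chains of their own (for larger [r]). After [i]
   rounds the neighbourhood of the fibre over [v] has growth of degree at
   least [i], which contradicts the polynomial bound. *)

(** * The word metric of the tree *)

Fixpoint lcp (x y : list nat) : nat :=
  match x, y with
  | a :: x', b :: y' => if a =? b then S (lcp x' y') else 0
  | _, _ => 0
  end.

(** The path metric of the tree of all words, whose edges append a last letter; paths from the root
    part at depth [lcp x y]. *)
Definition word_dist (x y : list nat) : nat :=
  length x + length y - 2 * lcp x y.

Lemma lcp_le x y : lcp x y <= length x /\ lcp x y <= length y.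
Proof.
  revert y; induction x as [|a x IH]; intros [|b y]; simpl; try lia.
  destruct (a =? b); [specialize (IH y)|]; lia.
Qed.

Lemma lcp_sym x y : lcp x y = lcp y x.
Proof.
  revert y; induction x as [|a x IH]; intros [|b y]; simpl; try lia.
  rewrite Nat.eqb_sym. destruct (b =? a); [rewrite IH|]; reflexivity.
Qed.

Lemma lcp_refl x : lcp x x = length x.
Proof. induction x; simpl; [|rewrite Nat.eqb_refl]; congruence. Qed.

Lemma lcp_ultrametric x y z : Nat.min (lcp x y) (lcp y z) <= lcp x z.
Proof.
  revert y z; induction x as [|a x IH]; intros [|b y] [|c z]; simpl; try lia.
  destruct (Nat.eqb_spec a b), (Nat.eqb_spec b c), (Nat.eqb_spec a c);
    subst; try congruence; try lia.
  specialize (IH y z); lia.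
Qed.

Lemma lcp_full x y : lcp x y = length x -> lcp x y = length y -> x = y.
Proof.
  revert y; induction x as [|a x IH]; intros [|b y]; simpl; try easy.
  destruct (Nat.eqb_spec a b); [subst|lia].
  intros H1 H2. f_equal. apply IH; lia.
Qed.

Lemma word_dist_refl x : word_dist x x = 0.
Proof. unfold word_dist. rewrite lcp_refl. lia. Qed.

Lemma word_dist_sym x y : word_dist x y = word_dist y x.
Proof. unfold word_dist. rewrite lcp_sym. lia. Qed.

Lemma word_dist_triangle x y z :
  word_dist x z <= word_dist x y + word_dist y z.
Proof.
  unfold word_dist.
  pose proof (lcp_le x y); pose proof (lcp_le y z);
  pose proof (lcp_le x z); pose proof (lcp_ultrametric x y z). lia.
Qed.

Lemma word_dist_eq0 x y : word_dist x y = 0 -> x = y.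
Proof.
  unfold word_dist. pose proof (lcp_le x y).
  intros. apply lcp_full; lia.
Qed.

(** Zero-hyperbolicity: the ultrametric inequality for [lcp], read with the empty word as base
    point. *)
Lemma word_dist_four_point x y z w :
  word_dist x y + word_dist z w <=
  Nat.max (word_dist x z + word_dist y w) (word_dist x w + word_dist y z).
Proof.
  unfold word_dist.
  pose proof (lcp_le x y); pose proof (lcp_le z w); pose proof (lcp_le x z);
  pose proof (lcp_le y w); pose proof (lcp_le x w); pose proof (lcp_le y z).
  pose proof (lcp_ultrametric x z y); pose proof (lcp_ultrametric x w y);
  pose proof (lcp_ultrametric z x w); pose proof (lcp_ultrametric z y w).
  rewrite (lcp_sym z y), (lcp_sym w y), (lcp_sym z x) in *. lia.
Qed.

Lemma lcp_firstn x k : lcp x (firstn k x) = Nat.min k (length x).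
Proof.
  revert k; induction x as [|a x IH]; intros [|k]; simpl; try lia.
  rewrite Nat.eqb_refl, IH. lia.
Qed.

Lemma word_dist_firstn x k :
  word_dist x (firstn k x) = length x - k.
Proof. unfold word_dist. rewrite lcp_firstn, length_firstn. lia. Qed.

Lemma word_geodesic r x y : r <= word_dist x y ->
  exists z, word_dist x z = r /\ r + word_dist z y = word_dist x y.
Proof.
  revert y; induction x as [|a x IH]; intros y Hr.
  - exists (firstn r y). rewrite (word_dist_sym _ y), word_dist_firstn.
    unfold word_dist in *; cbn [length lcp] in *. rewrite length_firstn. lia.
  - destruct y as [|b y].
    + exists (firstn (S (length x) - r) (a :: x)).
      rewrite word_dist_firstn. unfold word_dist in *.
      rewrite (lcp_sym (firstn _ _)), length_firstn. cbn [length lcp] in *.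
      lia.
    + destruct (Nat.eqb_spec a b) as [<-|Hab].
      * destruct (IH y) as [z Hz].
        { unfold word_dist in *; cbn [length lcp] in *.
          rewrite Nat.eqb_refl in Hr. lia. }
        exists (a :: z). unfold word_dist in *; cbn [length lcp] in *.
        rewrite !Nat.eqb_refl in *. lia.
      (* The geodesic runs through the empty word, so [z] is a prefix of one of the two ends. *)
      * assert (E : lcp (a :: x) (b :: y) = 0).
        { simpl. apply Nat.eqb_neq in Hab. rewrite Hab. reflexivity. }
        assert (E' : forall k, lcp (firstn k (a :: x)) (b :: y) = 0
                            /\ lcp (a :: x) (firstn k (b :: y)) = 0).
        { intros [|k]; [easy|].
          simpl. apply Nat.eqb_neq in Hab. rewrite Hab. easy. }
        destruct (le_lt_dec r (S (length x))) as [Hx|Hx].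
        -- exists (firstn (S (length x) - r) (a :: x)).
           rewrite word_dist_firstn. unfold word_dist in *.
           rewrite E in *. rewrite (proj1 (E' _)), length_firstn.
           cbn [length] in *. lia.
        -- exists (firstn (r - S (length x)) (b :: y)).
           rewrite (word_dist_sym _ (b :: y)), word_dist_firstn.
           unfold word_dist in *.
           rewrite E in *. rewrite (proj2 (E' _)), length_firstn.
           cbn [length] in *. lia.
Qed.

(* [beyond v w u]: some (hence every) geodesic from [v] to [u] runs through
   [w]. For fixed [v], these are the branches of the tree hanging at [w]. *)
Definition beyond (v w u : list nat) : bool :=
  word_dist v u =? word_dist v w + word_dist w u.

(** Leaving a branch means passing its gate [w]: in the four-point inequality the term with
    [word_dist v u'] is too small, as [u'] is not beyond [w]. *)
Lemma beyond_gate v w u u' : beyond v w u = true -> beyond v w u' = false ->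
  word_dist w u + word_dist w u' <= word_dist u u'.
Proof.
  unfold beyond. rewrite Nat.eqb_eq, Nat.eqb_neq. intros H H'.
  pose proof (word_dist_triangle v w u').
  pose proof (word_dist_four_point v u w u').
  rewrite (word_dist_sym u w) in *. lia.
Qed.

Lemma beyond_disjoint v w w' u : word_dist v w = word_dist v w' ->
  beyond v w u = true -> beyond v w' u = true -> w = w'.
Proof.
  unfold beyond. rewrite !Nat.eqb_eq. intros E H H'.
  apply word_dist_eq0.
  pose proof (word_dist_four_point v u w w').
  rewrite !(word_dist_sym u) in *. lia.
Qed.

Lemma beyond_exists v u r : r <= word_dist v u ->
  exists w, word_dist v w = r /\ beyond v w u = true /\
    r + word_dist w u = word_dist v u.
Proof.
  intros Hr. destruct (word_geodesic r v u Hr) as [w [E H]].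
  exists w. unfold beyond. rewrite Nat.eqb_eq. lia.
Qed.

(** * Counting descendants in the binary tiling *)

(* [(k, n)] stands for the point [(n / 2^k, 1 / 2^k)] of the half plane, with
   children [(k + 1, 2 n)] and [(k + 1, 2 n + 1)]; [row_count p s k n] counts
   its descendants in row [k + s] that satisfy [p]. *)
Fixpoint row_count (p : nat -> nat -> bool) (s k n : nat) : nat :=
  match s with
  | 0 => if p k n then 1 else 0
  | S s => row_count p s (S k) (2 * n) + row_count p s (S k) (2 * n + 1)
  end.

Lemma row_count_mono p q : (forall k n, p k n = true -> q k n = true) ->
  forall s k n, row_count p s k n <= row_count q s k n.
Proof.
  intros H s; induction s as [|s IH]; intros k n; simpl.
  - specialize (H k n). destruct (p k n); [rewrite H by reflexivity|]; lia.
  - apply Nat.add_le_mono; apply IH.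
Qed.

Lemma row_count_compl p s k n :
  row_count p s k n + row_count (fun k n => negb (p k n)) s k n = 2 ^ s.
Proof.
  revert k n; induction s as [|s IH]; intros k n; cbn [row_count].
  - destruct (p k n); reflexivity.
  - pose proof (IH (S k) (2 * n)); pose proof (IH (S k) (2 * n + 1)).
    cbn [Nat.pow]. lia.
Qed.

Lemma row_count_le p s k n : row_count p s k n <= 2 ^ s.
Proof. pose proof (row_count_compl p s k n). lia. Qed.

Lemma row_count_disjoint p q s k n :
  (forall k n, p k n = true -> q k n = true -> False) ->
  row_count p s k n + row_count q s k n <= 2 ^ s.
Proof.
  intros H. rewrite <- (row_count_compl p s k n).
  apply Nat.add_le_mono_l, row_count_mono.
  intros k' n' Hq. specialize (H k' n'). destruct (p k' n'); [tauto|easy].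
Qed.

Lemma row_count_filter p s k n :
  row_count p s k n = length (filter (p (k + s)) (seq (n * 2 ^ s) (2 ^ s))).
Proof.
  revert k n; induction s as [|s IH]; intros k n; cbn [row_count].
  - rewrite Nat.add_0_r, Nat.mul_1_r. simpl. destruct (p k n); reflexivity.
  - rewrite !IH, <- length_app.
    replace (S k + s) with (k + S s) by lia.
    replace (2 ^ S s) with (2 ^ s + 2 ^ s) by (simpl; lia).
    rewrite seq_app, filter_app.
    do 4 f_equal; nia.
Qed.

(** * Descendants leaving a region through its gate *)

Section Exit.
Local Open Scope R_scope.
Context (p q : nat -> nat -> bool).

Definition exits_through : Prop := forall k n i, (i < 2)%nat ->
  p k n = true -> p (S k) (2 * n + i)%nat = false ->
  q (S k) (2 * n + i)%nat = true.

(** A union bound: a descendant outside [p] is reached through a node of [q], and a node [j] rows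
    down carries the share [1 / 2 ^ j] of the descendants. Admitting starting nodes in [q] lets the
    induction pass to children. *)
Lemma exit_density : exits_through -> forall s k n,
  p k n = true \/ q k n = true ->
  INR (row_count (fun k n => negb (p k n)) s k n) / 2 ^ s <=
  sum_f_R0 (fun j => INR (row_count q j k n) / 2 ^ j) s.
Proof.
  intros Hpq s; induction s as [|s IH]; intros k n Hkn.
  - simpl. destruct (p k n), (q k n); simpl; try lra;
      destruct Hkn; discriminate.
  - assert (Hpow : 0 < 2 ^ s) by (apply pow_lt; lra).
    rewrite decomp_sum by lia. simpl pred.
    destruct (q k n) eqn:Hq.
    + apply Rle_trans with 1.
      * apply Rmult_le_reg_r with (2 ^ S s); [apply pow_lt; lra|].
        unfold Rdiv. rewrite Rmult_assoc, Rinv_l, Rmult_1_r, Rmult_1_l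
          by (apply pow_nonzero; lra).
        replace (2 ^ S s) with (INR (2 ^ S s))
          by (rewrite pow_INR; reflexivity).
        apply le_INR, row_count_le.
      * simpl row_count at 1. rewrite Hq.
        assert (0 <= sum_f_R0
          (fun i => INR (row_count q (S i) k n) / 2 ^ S i) s).
        { apply cond_pos_sum. intros j.
          apply Rmult_le_pos; [apply pos_INR|].
          left. apply Rinv_0_lt_compat, pow_lt. lra. }
        simpl in *. lra.
    + assert (Hp : p k n = true) by (destruct Hkn; congruence).
      assert (H0 := Hpq k n 0%nat ltac:(lia) Hp).
      assert (H1 := Hpq k n 1%nat ltac:(lia) Hp).
      rewrite Nat.add_0_r in H0.
      assert (IH0 := IH (S k) (2 * n)%nat
        ltac:(destruct (p (S k) (2 * n)%nat); tauto)).
      assert (IH1 := IH (S k) (2 * n + 1)%nat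
        ltac:(destruct (p (S k) (2 * n + 1)%nat); tauto)).
      assert (Hsplit : forall r s, INR (row_count r (S s) k n) / 2 ^ S s =
        (INR (row_count r s (S k) (2 * n)) / 2 ^ s +
         INR (row_count r s (S k) (2 * n + 1)) / 2 ^ s) * / 2).
      { intros r j. cbn [row_count]. rewrite plus_INR. simpl pow. field.
        apply pow_nonzero. lra. }
      rewrite Hsplit.
      erewrite (sum_eq (fun i => INR (row_count q (S i) k n) / 2 ^ S i));
        [|intros; apply Hsplit].
      rewrite <- scal_sum, sum_plus.
      simpl row_count at 3. rewrite Hq. simpl (INR 0). lra.
Qed.

(* The threshold makes the bound of [exit_density] at most
   [sum_j (3/4)^j / 32 <= 1/8]. *)
Lemma exit_count : exits_through -> forall s k n, p k n = true ->
  (forall j, 32 * INR (row_count q j k n) <= (3 / 2) ^ j) ->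
  (8 * row_count (fun k n => negb (p k n)) s k n <= 2 ^ s)%nat.
Proof.
  intros Hpq s k n Hp Hq.
  pose proof (exit_density Hpq s k n (or_introl Hp)) as Hd.
  assert (Hs : sum_f_R0 (fun j => INR (row_count q j k n) / 2 ^ j) s <= / 8).
  { apply Rle_trans with (sum_f_R0 (fun j => (3 / 4) ^ j * / 32) s).
    - apply sum_Rle. intros j _.
      apply Rmult_le_reg_r with (2 ^ j); [apply pow_lt; lra|].
      unfold Rdiv at 1. rewrite Rmult_assoc, Rinv_l, Rmult_1_r
        by (apply pow_nonzero; lra).
      replace ((3 / 4) ^ j * / 32 * 2 ^ j)
        with ((3 / 4) ^ j * 2 ^ j * / 32) by ring.
      rewrite <- Rpow_mult_distr.
      replace (3 / 4 * 2) with (3 / 2) by field.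
      specialize (Hq j). lra.
    - rewrite <- scal_sum, tech3 by lra.
      assert (0 < (3 / 4) ^ S s) by (apply pow_lt; lra). lra. }
  apply INR_le. rewrite mult_INR, pow_INR. change (INR 2) with 2.
  replace (INR 8) with 8 by (simpl; lra).
  assert (Hpow : 0 < 2 ^ s) by (apply pow_lt; lra).
  assert (H := Rle_trans _ _ _ Hd Hs).
  apply Rmult_le_compat_r with (r := 2 ^ s) in H; [|lra].
  unfold Rdiv in H. rewrite Rmult_assoc, Rinv_l, Rmult_1_r in H
    by (apply pow_nonzero; lra).
  lra.
Qed.

End Exit.

(** * Polynomial against exponential growth *)

Lemma poly_le_exp_const (d : nat) (q : R) : (1 < q)%R ->
  exists K : R, (0 < K)%R /\ forall j, (INR (S j) ^ d <= K * q ^ j)%R.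
Proof.
  revert q; induction d as [|d IH]; intros q Hq.
  - exists 1%R. split; [lra|]. intros j. simpl.
    pose proof (pow_R1_Rle q j ltac:(lra)). lra.
  - assert (Hp : (1 < sqrt q)%R)
      by (rewrite <- sqrt_1; apply sqrt_lt_1; lra).
    assert (Hsq : (sqrt q * sqrt q = q)%R) by (apply sqrt_sqrt; lra).
    destruct (IH (sqrt q) Hp) as [K [HK Hd]].
    (* One factor [sqrt q ^ j] absorbs the extra [INR (S j)]: Bernoulli's inequality [poly] gives
       [INR (S j) <= K' * sqrt q ^ j]. *)
    set (K' := (1 + / (sqrt q - 1))%R).
    assert (HK' : (0 < / (sqrt q - 1))%R) by (apply Rinv_0_lt_compat; lra).
    assert (Hinv : (/ (sqrt q - 1) * (sqrt q - 1) = 1)%R)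
      by (apply Rinv_l; lra).
    exists (K' * K)%R. split; [unfold K'; nra|]. intros j.
    assert (Hlin : (INR (S j) <= K' * sqrt q ^ j)%R).
    { pose proof (poly j (sqrt q - 1) ltac:(lra)) as Hb.
      replace (1 + (sqrt q - 1))%R with (sqrt q) in Hb by ring.
      rewrite S_INR.
      pose proof (pos_INR j).
      apply Rle_trans with (K' * (1 + INR j * (sqrt q - 1)))%R;
        [|apply Rmult_le_compat_l; unfold K'; lra].
      unfold K'. nra. }
    rewrite <- Hsq, Rpow_mult_distr.
    change (INR (S j) ^ S d)%R with (INR (S j) * INR (S j) ^ d)%R.
    replace (K' * K * (sqrt q ^ j * sqrt q ^ j))%R
      with ((K' * sqrt q ^ j) * (K * sqrt q ^ j))%R by ring.
    apply Rmult_le_compat; auto; [apply pos_INR|].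
    apply pow_le, pos_INR.
Qed.

Lemma poly_le_exp (d M : nat) (q : R) : (1 < q)%R ->
  exists j0, forall j, j0 <= j -> (INR (M * S j ^ d) <= q ^ j)%R.
Proof.
  intros Hq.
  assert (Hp : (1 < sqrt q)%R)
    by (rewrite <- sqrt_1; apply sqrt_lt_1; lra).
  assert (Hsq : (sqrt q * sqrt q = q)%R) by (apply sqrt_sqrt; lra).
  destruct (poly_le_exp_const d (sqrt q) Hp) as [K [HK Hd]].
  destruct (Pow_x_infinity (sqrt q) ltac:(rewrite Rabs_right; lra)
    (INR M * K)%R) as [j0 Hj0].
  exists j0. intros j Hj. specialize (Hj0 j Hj). specialize (Hd j).
  assert (0 < sqrt q ^ j)%R by (apply pow_lt; lra).
  rewrite Rabs_right in Hj0 by lra.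
  rewrite mult_INR, pow_INR, <- Hsq, Rpow_mult_distr.
  apply Rle_trans with (INR M * K * sqrt q ^ j)%R.
  - rewrite Rmult_assoc. apply Rmult_le_compat_l; [apply pos_INR|exact Hd].
  - apply Rmult_le_compat_r; lra.
Qed.

(** * Growth of the fibres over the tree *)

Section Growth.
Context (g : nat -> nat -> list nat) (L : nat)
  (g_horizontal : forall k n, word_dist (g k n) (g k (n + 1)) <= L)
  (g_vertical : forall k n i, i < 2 ->
     word_dist (g k n) (g (S k) (2 * n + i)) <= L).

Definition near (v : list nat) (r k n : nat) : bool :=
  word_dist v (g k n) <=? r.

Definition branch (v w : list nat) (k n : nat) : bool := beyond v w (g k n).

Lemma row_count_near_far v r s k n :
  r + L * s < word_dist v (g k n) -> row_count (near v r) s k n = 0.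
Proof.
  revert k n; induction s as [|s IH]; intros k n H; cbn [row_count].
  - unfold near. destruct (Nat.leb_spec (word_dist v (g k n)) r); lia.
  - assert (Hi : forall i, i < 2 ->
      r + L * s < word_dist v (g (S k) (2 * n + i))).
    { intros i Hi. specialize (g_vertical k n i Hi).
      pose proof (word_dist_triangle v (g (S k) (2 * n + i)) (g k n)).
      rewrite (word_dist_sym (g (S k) _) (g k n)) in *. nia. }
    rewrite !IH; [reflexivity| |]; auto.
    replace (2 * n) with (2 * n + 0) by lia. auto.
Qed.

(** Both sides of a branch share one gate: an edge moves [g] by at most [L], so by [beyond_gate] a
    crossing edge ends within [L] of [w]. *)
Lemma branch_exits_through v w :
  exits_through (branch v w) (near w L) /\
  exits_through (fun k n => negb (branch v w k n)) (near w L).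
Proof.
  unfold branch, near.
  split; intros k n i Hi; specialize (g_vertical k n i Hi).
  - intros H H'. pose proof (beyond_gate _ _ _ _ H H').
    apply Nat.leb_le. lia.
  - rewrite negb_true_iff, negb_false_iff. intros H H'.
    pose proof (beyond_gate _ _ _ _ H' H) as Hd.
    rewrite (word_dist_sym (g (S k) _)) in Hd. apply Nat.leb_le. lia.
Qed.

(** [D] is fixed before [r]; the final contradiction is between degrees, at a radius that depends on
    [D]. *)
Context (D : nat)
  (fibre_growth : forall r, exists M, forall v k n s,
     row_count (near v r) s k n <= M * S s ^ D).

(** Rows before [j0] cannot reach a gate farther than [L + L * j0]; from [j0] on the polynomial
    bound is below the threshold of [exit_count]. *)
Lemma far_from_gate : exists rho, L <= rho /\ forall v w k n s,
  rho < word_dist w (g k n) ->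
  (branch v w k n = true ->
     8 * row_count (fun k n => negb (branch v w k n)) s k n <= 2 ^ s) /\
  (branch v w k n = false -> 8 * row_count (branch v w) s k n <= 2 ^ s).
Proof.
  destruct (fibre_growth L) as [M HM].
  destruct (poly_le_exp D (32 * M) (3 / 2) ltac:(lra)) as [j0 Hj0].
  exists (L + L * j0). split; [lia|]. intros v w k n s Hfar.
  assert (Hsmall : forall j,
    (32 * INR (row_count (near w L) j k n) <= (3 / 2) ^ j)%R).
  { intros j. destruct (le_lt_dec j0 j) as [Hj|Hj].
    - apply Rle_trans with (2 := Hj0 j Hj).
      replace 32%R with (INR 32) by (simpl; lra).
      rewrite <- mult_INR. apply le_INR. specialize (HM w k n j). lia.
    - rewrite row_count_near_far by nia. simpl.
      pose proof (pow_lt (3 / 2) j ltac:(lra)). lra. }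
  destruct (branch_exits_through v w) as [Hin Hout].
  split; intros H.
  - apply exit_count with (q := near w L); auto.
  - eapply Nat.le_trans;
      [|apply (exit_count _ _ Hout s k n); [rewrite H; reflexivity|auto]].
    apply Nat.mul_le_mono_l, row_count_mono.
    intros. rewrite negb_involutive. assumption.
Qed.

(** The bound is three quarters of the pair's [2 * 2 ^ s] descendants, so that each node alone must
    send more than half of its own into the branch. *)
Definition concentrated (v : list nat) (r s k n : nat) : Prop :=
  exists w, word_dist v w = r /\
    3 * 2 ^ s < 2 * (row_count (branch v w) s k n +
                     row_count (branch v w) s k (n + 1)).

(** Successive pairs of the four children share a node, whose majority forces their branches to
    agree. The two outer pairs then add up to the parents' pair. *)
Lemma concentrated_parent v r s k n :
  (forall i, i < 3 -> concentrated v r s (S k) (2 * n + i)) ->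
  concentrated v r (S s) k n.
Proof.
  intros H.
  assert (Huniq : forall w w' m, word_dist v w = r -> word_dist v w' = r ->
    2 ^ s < 2 * row_count (branch v w) s (S k) m ->
    2 ^ s < 2 * row_count (branch v w') s (S k) m -> w = w').
  { intros w w' m E E' Hw Hw'. apply NNPP. intros Hne.
    pose proof (row_count_disjoint (branch v w) (branch v w') s (S k) m) as Hd.
    enough (row_count (branch v w) s (S k) m +
            row_count (branch v w') s (S k) m <= 2 ^ s) by lia.
    apply Hd. intros k' n' Hb Hb'. apply Hne.
    apply (beyond_disjoint v w w' (g k' n')); congruence || assumption. }
  destruct (H 0) as [w0 [E0 H0]]; [lia|].
  destruct (H 1) as [w1 [E1 H1]]; [lia|].
  destruct (H 2) as [w2 [E2 H2]]; [lia|].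
  rewrite Nat.add_0_r in H0.
  replace (2 * n + 1 + 1) with (2 * n + 2) in H1 by lia.
  pose proof (row_count_le (branch v w0) s (S k) (2 * n)).
  pose proof (row_count_le (branch v w1) s (S k) (2 * n + 1)).
  pose proof (row_count_le (branch v w1) s (S k) (2 * n + 2)).
  pose proof (row_count_le (branch v w2) s (S k) (2 * n + 2 + 1)).
  assert (w1 = w0) as -> by (apply (Huniq w1 w0 (2 * n + 1)); lia).
  assert (w2 = w0) as -> by (apply (Huniq w2 w0 (2 * n + 2)); lia).
  exists w0. split; [exact E0|]. cbn [row_count Nat.pow].
  replace (2 * (n + 1)) with (2 * n + 2) by lia. lia.
Qed.

(** If one node is far out, its neighbour lies in the same branch at distance [r], as an edge is too
    short to cross the distant gate. Each then loses at most an eighth of its descendants, so the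
    pair is concentrated. *)
Lemma not_concentrated_near v r : exists r', r <= r' /\ forall s k n,
  ~ concentrated v r s k n ->
  word_dist v (g k n) <= r' /\ word_dist v (g k (n + 1)) <= r'.
Proof.
  destruct far_from_gate as [rho [HL Hrho]].
  exists (r + rho + L). split; [lia|].
  (* [m], [m'] are [n], [n + 1] in either order, the far node first. *)
  assert (Haux : forall s k n m m',
    word_dist (g k m) (g k m') <= L ->
    r + rho + L < word_dist v (g k m) ->
    (forall w, row_count (branch v w) s k n +
       row_count (branch v w) s k (n + 1) =
       row_count (branch v w) s k m + row_count (branch v w) s k m') ->
    concentrated v r s k n).
  { intros s k n m m' Hmm Hfar Hsum.
    destruct (beyond_exists v (g k m) r ltac:(lia)) as [w [E [Hb Hd]]].
    exists w. split; [exact E|].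
    assert (Hb' : beyond v w (g k m') = true).
    { apply not_false_is_true. intros Hb'.
      pose proof (beyond_gate _ _ _ _ Hb Hb'). lia. }
    pose proof (word_dist_triangle w (g k m') (g k m)).
    rewrite (word_dist_sym (g k m')) in *.
    destruct (Hrho v w k m s ltac:(lia)) as [Hm _].
    destruct (Hrho v w k m' s ltac:(lia)) as [Hm' _].
    specialize (Hm Hb). specialize (Hm' Hb').
    pose proof (row_count_compl (branch v w) s k m).
    pose proof (row_count_compl (branch v w) s k m').
    rewrite Hsum.
    pose proof (Nat.pow_nonzero 2 s ltac:(lia)). lia. }
  intros s k n Hc. split; apply Nat.nlt_ge; intros Hfar; apply Hc.
  - apply (Haux s k n n (n + 1)); auto.
  - apply (Haux s k n (n + 1) n); auto; [|intros; lia].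
    rewrite word_dist_sym. apply g_horizontal.
Qed.

(** Supplies the first pair of a chain: both children stay on the side of [v] of every gate at
    distance [r'], farther than [rho] from it, so each sends at most an eighth of its descendants
    across. *)
Lemma child_not_concentrated v r : exists r', forall s k n,
  word_dist v (g k n) <= r -> ~ concentrated v r' s (S k) (2 * n).
Proof.
  destruct far_from_gate as [rho [HL Hrho]].
  exists (r + L + rho + 1). intros s k n Hn [w [E Hc]].
  assert (Hi : forall i, i < 2 ->
    8 * row_count (branch v w) s (S k) (2 * n + i) <= 2 ^ s).
  { intros i Hi. specialize (g_vertical k n i Hi).
    pose proof (word_dist_triangle v (g k n) (g (S k) (2 * n + i))).
    pose proof (word_dist_triangle v (g (S k) (2 * n + i)) w).
    rewrite (word_dist_sym (g (S k) _) w) in *.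
    apply (Hrho v w (S k) (2 * n + i) s); [lia|].
    apply Nat.eqb_neq. lia. }
  pose proof (Hi 0 ltac:(lia)) as H0. pose proof (Hi 1 ltac:(lia)).
  rewrite Nat.add_0_r in H0.
  pose proof (Nat.pow_nonzero 2 s ltac:(lia)). lia.
Qed.

(* An unconcentrated pair of nodes contains an unconcentrated pair of children.
   This gives a descending chain of pairs that stay close to [v], and at each
   level of it a further child splits off, which is also close to [v]. *)
Lemma near_growth v r : exists r1, forall r2 a b, r1 <= r2 ->
  (forall k n s, word_dist v (g k n) <= r1 -> a <= s ->
     b <= row_count (near v r2) s k n) ->
  forall k n s, word_dist v (g k n) <= r ->
    1 + (s - 1 - a) * b <= row_count (near v r2) s k n.
Proof.
  destruct (child_not_concentrated v r) as [rc Hrc].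
  destruct (not_concentrated_near v rc) as [rn [Hle Hrn]].
  exists (Nat.max r (rn + L)). intros r2 a b Hr2 Hb.
  assert (Hpair : forall s k n, ~ concentrated v rc s k n ->
    1 + (s - a) * b <=
    row_count (near v r2) s k n + row_count (near v r2) s k (n + 1)).
  { intros s; induction s as [|s IH]; intros k n Hc.
    - destruct (Hrn _ _ _ Hc) as [Hn _]. cbn [row_count]. unfold near.
      destruct (Nat.leb_spec (word_dist v (g k n)) r2); lia.
    - assert (Hsub : exists i, i < 3 /\
        ~ concentrated v rc s (S k) (2 * n + i)).
      { apply NNPP. intros Hno. apply Hc, concentrated_parent.
        intros i Hi. apply NNPP. intros Hci. apply Hno. eauto. }
      destruct (Hrn _ _ _ Hc) as [Hn Hn'].
      (* All four children are within [rn + L] of [v], so each contributes [b] while at least [a]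
         rows remain below it. *)
      assert (Hside : forall i, i < 4 -> a <= s ->
        b <= row_count (near v r2) s (S k) (2 * n + i)).
      { intros i Hi. apply Hb.
        assert (i < 2 \/ exists i', i' < 2 /\ 2 * n + i = 2 * (n + 1) + i')
          as [Hi2|[i' [Hi' ->]]].
        { destruct (le_lt_dec 2 i); [right; exists (i - 2)|]; lia. }
        - specialize (g_vertical k n i Hi2).
          pose proof (word_dist_triangle v (g k n) (g (S k) (2 * n + i))).
          lia.
        - specialize (g_vertical k (n + 1) i' Hi').
          pose proof (word_dist_triangle v (g k (n + 1))
            (g (S k) (2 * (n + 1) + i'))).
          lia. }
      destruct Hsub as [i [Hi Hci]]. specialize (IH _ _ Hci).
      (* Whichever pair [i], [i + 1] is kept, child [0] or child [3] lies outside it. *)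
      pose proof (Hside 0 ltac:(lia)) as H0.
      pose proof (Hside 3 ltac:(lia)) as H3.
      rewrite Nat.add_0_r in H0. cbn [row_count].
      replace (2 * (n + 1) + 1) with (2 * n + 3) by lia.
      replace (2 * (n + 1)) with (2 * n + 2) by lia.
      assert (Harith : (S s - a) * b <= (s - a) * b + if a <=? s then b else 0).
      { destruct (Nat.leb_spec a s) as [Ha|Ha].
        - rewrite Nat.sub_succ_l by lia. simpl. lia.
        - replace (S s - a) with 0 by lia. simpl. lia. }
      destruct (Nat.leb_spec a s) as [Ha|Ha];
        [specialize (H0 Ha); specialize (H3 Ha)|];
        destruct i as [|[|[|i]]]; try lia;
        rewrite ?Nat.add_0_r, <- ?Nat.add_assoc in IH; simpl (1 + 1) in IH;
        simpl (2 + 1) in IH; lia. }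
  intros k n [|s] Hn.
  - cbn [row_count]. unfold near.
    destruct (Nat.leb_spec (word_dist v (g k n)) r2); lia.
  (* One row is spent on passing to the two children, which form the first pair. *)
  - cbn [row_count]. replace (S s - 1) with s by lia. apply Hpair; auto.
Qed.

(** Each use of [near_growth] raises the degree by one: with [a = i * (t + 1)] and [b = t ^ i], at
    least [t] levels contribute. The radius must not depend on [t], which later tends to outgrow
    [M]. *)
Lemma near_growth_pow v i r : exists r', forall t k n s,
  word_dist v (g k n) <= r -> i * (t + 1) <= s ->
  t ^ i <= row_count (near v r') s k n.
Proof.
  revert r; induction i as [|i IH]; intros r;
    destruct (near_growth v r) as [r1 Hr1].
  - exists r1. intros t k n s Hn _.
    pose proof (Hr1 r1 0 0 (le_n _) ltac:(intros; lia) k n s Hn). simpl. lia.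
  - destruct (IH r1) as [r' Hr'].
    exists (Nat.max r1 r'). intros t k n s Hn Hs.
    assert (H := Hr1 (Nat.max r1 r') (i * (t + 1)) (t ^ i) ltac:(lia)).
    eapply Nat.le_trans; [|apply H; [|exact Hn]].
    + simpl Nat.pow. nia.
    + intros k' n' s' Hn' Hs'.
      eapply Nat.le_trans; [apply (Hr' t k' n' s' Hn' Hs')|].
      apply row_count_mono. unfold near. intros k'' n''.
      rewrite !Nat.leb_le. lia.
Qed.

Lemma no_polynomial_fibres : False.
Proof.
  destruct (near_growth_pow (g 0 0) (S D) 0) as [r Hr].
  destruct (fibre_growth r) as [M HM].
  (* [c * t] bounds [S s] for the row [s = S D * (t + 1)], and [t > M * c ^ D] makes [t ^ S D]
     exceed [M * (c * t) ^ D]. *)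
  set (c := 2 * D + 3).
  set (t := M * c ^ D + 1).
  assert (H := Hr t 0 0 (S D * (t + 1)) ltac:(rewrite word_dist_refl; lia)
    (le_n _)).
  assert (H' := HM (g 0 0) 0 0 (S D * (t + 1))).
  assert (S (S D * (t + 1)) <= c * t) as Hlin
    by (unfold c; assert (1 <= t) by (unfold t; lia); nia).
  apply (Nat.pow_le_mono_l _ _ D) in Hlin. rewrite Nat.pow_mul_l in Hlin.
  assert (0 < t ^ D) by (apply Nat.neq_0_lt_0, Nat.pow_nonzero; unfold t; lia).
  apply (Nat.mul_le_mono_l _ _ M) in Hlin.
  simpl (t ^ S D) in H. unfold t at 1 in H. nia.
Qed.

End Growth.

(** * Regular maps restricted to the binary tiling *)

Section GraphDist.
Context {V : Type} (adj : V -> V -> Prop).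

Lemma graph_dist_spec u v : (exists n, walk adj u v n) ->
  exists n, graph_dist adj u v = INR n /\ walk adj u v n /\
    forall m, walk adj u v m -> n <= m.
Proof.
  intros Hex. unfold graph_dist.
  match goal with |- context [epsilon ?i ?P] =>
    exists (epsilon i P); split; [reflexivity|apply (epsilon_spec i P)] end.
  destruct (dec_inh_nat_subset_has_unique_least_element
    (fun n => walk adj u v n) (fun n => classic _) Hex) as [n [Hn _]].
  exists n. exact Hn.
Qed.

Lemma graph_dist_refl v : graph_dist adj v v = 0%R.
Proof.
  destruct (graph_dist_spec v v) as [n [-> [_ Hmin]]].
  - exists 0. constructor.
  - specialize (Hmin 0 (walk0 _ _)). replace n with 0 by lia. reflexivity.
Qed.

Lemma graph_dist_nonneg u v : (0 <= graph_dist adj u v)%R.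
Proof. apply pos_INR. Qed.

Lemma walk_app u v w m n :
  walk adj u v m -> walk adj v w n -> walk adj u w (m + n).
Proof.
  intros H; induction H; intros H'; simpl; [assumption|].
  econstructor; eauto.
Qed.

Lemma walk_rev (Hsym : symmetric_rel adj) u v n :
  walk adj u v n -> walk adj v u n.
Proof.
  intros H; induction H as [|u w v n Huw _ IH]; [constructor|].
  rewrite <- Nat.add_1_r. eapply walk_app; [exact IH|].
  econstructor; [apply Hsym, Huw|constructor].
Qed.

Lemma graph_dist_triangle (Hconn : connected_graph adj) u v w :
  (graph_dist adj u w <= graph_dist adj u v + graph_dist adj v w)%R.
Proof.
  destruct (graph_dist_spec u v (Hconn u v)) as [m [-> [Hm _]]].
  destruct (graph_dist_spec v w (Hconn v w)) as [n [-> [Hn _]]].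
  destruct (graph_dist_spec u w (Hconn u w)) as [l [-> [_ Hl]]].
  rewrite <- plus_INR. apply le_INR, Hl. eapply walk_app; eauto.
Qed.

End GraphDist.

(** * The 3-regular tree as a set of words *)

Lemma T3_adj_sym : symmetric_rel T3_adj.
Proof. intros u v [H|H]; [right|left]; exact H. Qed.

Lemma T3_connected : connected_graph T3_adj.
Proof.
  set (root := exist (fun w => reducedb w = true) [] eq_refl : T3).
  assert (Hroot : forall u, exists n, walk T3_adj u root n).
  { intros [w Hw]. induction w as [|a w IH].
    - exists 0. unfold root. rewrite (UIP_dec bool_dec Hw eq_refl).
      constructor.
    - assert (Hw' : reducedb w = true).
      { cbn in Hw. rewrite !andb_true_iff in Hw. tauto. }
      destruct (IH Hw') as [n Hn]. exists (S n).
      econstructor; [|exact Hn]. right. exists a. reflexivity. }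
  intros u v. destruct (Hroot u) as [m Hm]. destruct (Hroot v) as [n Hn].
  exists (m + n). eapply walk_app; [exact Hm|].
  apply (walk_rev _ T3_adj_sym), Hn.
Qed.

(** Reversed because edges of [T3] add letters at the head, whereas those of [word_dist] add them at
    the end. *)
Definition T3_word (u : T3) : list nat := rev (proj1_sig u).

Lemma T3_word_inj u v : T3_word u = T3_word v -> u = v.
Proof.
  intros H. apply (f_equal (@rev nat)) in H.
  unfold T3_word in H. rewrite !rev_involutive in H.
  destruct u as [u Hu], v as [v Hv]. simpl in H. subst v.
  f_equal. apply UIP_dec, bool_dec.
Qed.

Lemma word_dist_snoc x a : word_dist x (x ++ [a]) = 1.
Proof.
  assert (E : lcp x (x ++ [a]) = length x).
  { induction x; simpl; [|rewrite Nat.eqb_refl]; congruence. }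
  unfold word_dist. rewrite E, length_app. simpl. lia.
Qed.

Lemma word_dist_le_T3_dist u v :
  (INR (word_dist (T3_word u) (T3_word v)) <= T3_dist u v)%R.
Proof.
  unfold T3_dist.
  destruct (graph_dist_spec T3_adj u v (T3_connected u v))
    as [n [-> [Hn _]]].
  apply le_INR. induction Hn as [v|u w v n Huw _ IH].
  - rewrite word_dist_refl. lia.
  - pose proof (word_dist_triangle (T3_word u) (T3_word w) (T3_word v)).
    enough (word_dist (T3_word u) (T3_word w) = 1) by lia.
    unfold T3_word. destruct Huw as [[a ->]|[a ->]]; simpl rev.
    + apply word_dist_snoc.
    + rewrite word_dist_sym. apply word_dist_snoc.
Qed.

Fixpoint words (r : nat) : list (list nat) :=
  match r with
  | 0 => [[]]
  | S r => [] :: flat_map (fun x => [0 :: x; 1 :: x; 2 :: x]) (words r)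
  end.

Lemma in_words r x : length x <= r -> Forall (fun a => a < 3) x ->
  In x (words r).
Proof.
  revert x; induction r as [|r IH]; intros [|a x] Hl Hx; simpl in *;
    try lia; auto.
  inversion Hx; subst. right. apply in_flat_map. exists x. split.
  - apply IH; [lia|assumption].
  - destruct a as [|[|[|a]]]; simpl; auto; lia.
Qed.

Lemma lcp_split x y : firstn (lcp x y) x = firstn (lcp x y) y.
Proof.
  revert y; induction x as [|a x IH]; intros [|b y]; simpl; try easy.
  destruct (Nat.eqb_spec a b); simpl; [subst; f_equal; auto|reflexivity].
Qed.

(** A word within [r] of [w] arises by cutting at most [r] last letters and appending at most [r].
    The list may overcount, but its length depends on [r] alone. *)
Definition word_ball (w : list nat) (r : nat) : list (list nat) :=
  flat_map (fun i => map (fun p => firstn (length w - i) w ++ p) (words r))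
    (seq 0 (S r)).

Lemma length_word_ball w r :
  length (word_ball w r) = S r * length (words r).
Proof.
  unfold word_ball. rewrite <- (length_seq (S r) 0) at 2.
  induction (seq 0 (S r)) as [|i l IH]; simpl; [reflexivity|].
  rewrite length_app, length_map, IH. reflexivity.
Qed.

Lemma in_word_ball w r x : word_dist w x <= r ->
  Forall (fun a => a < 3) x -> In x (word_ball w r).
Proof.
  unfold word_dist. intros Hd Hx. pose proof (lcp_le w x).
  apply in_flat_map. exists (length w - lcp w x). split.
  - apply in_seq. lia.
  - apply in_map_iff. exists (skipn (lcp w x) x). split.
    + replace (length w - (length w - lcp w x)) with (lcp w x) by lia.
      rewrite lcp_split. apply firstn_skipn.
    + apply in_words.
      * rewrite length_skipn. lia.
      * rewrite Forall_forall in *. intros a Ha. apply Hx.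
        rewrite <- (firstn_skipn (lcp w x)). apply in_app_iff. auto.
Qed.

Lemma T3_word_letters u : Forall (fun a => a < 3) (T3_word u).
Proof.
  apply Forall_rev. destruct u as [w Hw]. simpl.
  induction w as [|a w IH]; constructor; cbn in Hw;
    rewrite !andb_true_iff in Hw; destruct Hw as [[Ha _] Hw]; auto.
  apply Nat.ltb_lt, Ha.
Qed.

Lemma cover_union {A B : Type} (P : A -> B -> Prop) (l : list A) (N : nat) :
  (forall a, In a l -> exists lb, length lb <= N /\
     forall b, P a b -> In b lb) ->
  exists lb, length lb <= N * length l /\
    forall a b, In a l -> P a b -> In b lb.
Proof.
  induction l as [|a l IH]; intros H.
  - exists []. simpl. split; [lia|tauto].
  - destruct IH as [l1 [Hl1 H1]]; [intros; apply H; simpl; auto|].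
    destruct (H a) as [l2 [Hl2 H2]]; [simpl; auto|].
    exists (l2 ++ l1). rewrite length_app. simpl. split; [nia|].
    intros a' b [->|Ha'] Hb; apply in_app_iff; eauto.
Qed.

(** * Points of the binary tiling in the half plane *)

Section Dyadic.
Local Open Scope R_scope.

Lemma dyadic_height_pos k : 0 < / 2 ^ k.
Proof. apply Rinv_0_lt_compat, pow_lt. lra. Qed.

Definition dyadic (k n : nat) : H2 :=
  exist (fun p => 0 < snd p) (INR n * / 2 ^ k, / 2 ^ k)
    (dyadic_height_pos k).

Lemma hyp_dist_dyadic_horizontal k n :
  hyp_dist (dyadic k n) (dyadic k (n + 1)) = arcosh (3 / 2).
Proof.
  unfold hyp_dist. simpl. f_equal. rewrite plus_INR. simpl. field.
  apply pow_nonzero. lra.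
Qed.

Lemma hyp_dist_dyadic_left k n :
  hyp_dist (dyadic k n) (dyadic (S k) (2 * n)) = arcosh (5 / 4).
Proof.
  unfold hyp_dist, dyadic. cbn [proj1_sig]. f_equal.
  rewrite mult_INR. simpl. field. apply pow_nonzero. lra.
Qed.

Lemma hyp_dist_dyadic_right k n :
  hyp_dist (dyadic k n) (dyadic (S k) (2 * n + 1)) = arcosh (3 / 2).
Proof.
  unfold hyp_dist, dyadic. cbn [proj1_sig]. f_equal.
  rewrite plus_INR, mult_INR. simpl. field. apply pow_nonzero. lra.
Qed.

Lemma arcosh_lt_1 t : 1 <= t -> arcosh t < 1 -> t < 3.
Proof.
  unfold arcosh. intros Ht H.
  assert (0 <= sqrt (t * t - 1)) by apply sqrt_pos.
  apply (Rlt_le_trans _ _ (ln (exp 1))) in H; [|rewrite ln_exp; lra].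
  apply ln_lt_inv in H; [|lra|apply exp_pos].
  pose proof exp_le_3. lra.
Qed.

(** Distance below [1] means hyperbolic cosine below [3], since [exp 1 <= 3]. At height
    [h = / 2 ^ k] this keeps the horizontal offset below [5 * h], that is, five steps of the row. *)
Lemma dyadic_near_center c k m :
  hyp_dist (dyadic k m) c < 1 ->
  Rabs (INR m - fst (proj1_sig c) * 2 ^ k) < 5.
Proof.
  destruct c as [[x y] Hy]. unfold hyp_dist, dyadic. cbn in *.
  set (h := / 2 ^ k). assert (Hh : 0 < h) by apply dyadic_height_pos.
  assert (Hinv : h * 2 ^ k = 1)
    by (apply Rinv_l, pow_nonzero; lra).
  set (X := INR m * h - x).
  intros H. apply arcosh_lt_1 in H.
  - assert (Hq : X * (X * 1) + (h - y) * ((h - y) * 1) < 2 * (2 * h * y)).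
    { assert (Hhy : 0 < 2 * h * y) by nra.
      apply Rmult_lt_reg_r with (/ (2 * h * y));
        [apply Rinv_0_lt_compat, Hhy|].
      replace (2 * (2 * h * y) * / (2 * h * y)) with 2
        by (field; split; lra).
      fold X in H. lra. }
    assert (Hy6 : y < 6 * h) by nra.
    assert (HX : X * X < (5 * h) * (5 * h)) by nra.
    apply Rsqr_lt_abs_0 in HX. rewrite (Rabs_right (5 * h)) in HX by lra.
    replace (INR m - x * 2 ^ k) with (X * 2 ^ k)
      by (unfold X; rewrite Rmult_minus_distr_r, Rmult_assoc, Hinv; ring).
    assert (0 < 2 ^ k) by (apply pow_lt; lra).
    rewrite Rabs_mult, (Rabs_right (2 ^ k)) by lra.
    replace 5 with (5 * h * 2 ^ k) by (rewrite Rmult_assoc, Hinv; ring).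
    apply Rmult_lt_compat_r; assumption.
  - rewrite <- (Rplus_0_r 1) at 1. apply Rplus_le_compat_l, Rmult_le_pos.
    + pose proof (Rle_0_sqr X). pose proof (Rle_0_sqr (h - y)).
      unfold Rsqr in *. lra.
    + left. apply Rinv_0_lt_compat. nra.
Qed.

Lemma dyadic_row_ball c k : exists l : list nat, (length l <= 20)%nat /\
  forall m, hyp_dist (dyadic k m) c < 1 -> In m l.
Proof.
  destruct (classic (exists m, hyp_dist (dyadic k m) c < 1))
    as [[m0 Hm0]|Hno].
  (* Two indices in the ball differ by less than [10]; if [m0 - 9] is truncated to [0], the window
     still reaches past [m0 + 9]. *)
  - exists (seq (m0 - 9) 20). rewrite length_seq. split; [lia|].
    intros m Hm.
    apply dyadic_near_center in Hm, Hm0.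
    apply Rabs_def2 in Hm, Hm0. apply in_seq.
    assert (H1 : INR m < INR (m0 + 10)) by (rewrite plus_INR; simpl; lra).
    assert (H2 : INR m0 < INR (m + 10)) by (rewrite plus_INR; simpl; lra).
    apply INR_lt in H1, H2. lia.
  - exists []. split; [simpl; lia|]. intros m Hm. exfalso. eauto.
Qed.

End Dyadic.

(** * Polynomial bounds on the fibres *)

Lemma growth_nat {V : Type} (adj : V -> V -> Prop) (L : nat) :
  polynomial_growth adj -> exists A D, forall z s, exists ball : list V,
    length ball <= A * S s ^ D /\
    forall w, (graph_dist adj z w <= INR (L * s))%R -> In w ball.
Proof.
  intros [C [d [HC [Hd Hball]]]].
  destruct (INR_unbounded d) as [D HD].
  destruct (INR_unbounded (C * INR (S L) ^ D + C)) as [A HA].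
  exists A, D. intros z s.
  (* As [r >= 1], the real exponent [d] may be rounded up to [D]; the product form splits off the
     constant [INR (S L) ^ D]. *)
  set (r := INR (S L * S s)).
  assert (Hr : (1 <= r)%R) by (apply (le_INR 1); nia).
  destruct (Hball z r ltac:(lra)) as [ball [Hlen Hin]].
  exists ball. split.
  - apply INR_le. eapply Rle_trans; [exact Hlen|].
    assert (Hpow : (Rpower r d <= INR (S L) ^ D * INR (S s) ^ D)%R).
    { rewrite <- Rpow_mult_distr, <- mult_INR. fold r.
      rewrite <- (Rpower_pow D r) by lra.
      apply Rle_Rpower; lra. }
    assert (Hs : (1 <= INR (S s) ^ D)%R).
    { apply pow_R1_Rle, (le_INR 1). lia. }
    rewrite mult_INR, pow_INR.
    apply Rle_trans with ((C * INR (S L) ^ D + C) * INR (S s) ^ D)%R; nra.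
  - intros w Hw. apply Hin. eapply Rle_trans; [exact Hw|].
    apply le_INR. nia.
Qed.

Section Fibres.
Context {V : Type} (adj : V -> V -> Prop) (Hconn : connected_graph adj)
  (f : H2 -> T3 * V) (L : nat).

Definition tree_word (k n : nat) : list nat := T3_word (fst (f (dyadic k n))).

Context (f_vertical : forall k n i, i < 2 ->
  (graph_dist adj (snd (f (dyadic k n)))
     (snd (f (dyadic (S k) (2 * n + i)))) <= INR L)%R).

Lemma drift k n s m : n * 2 ^ s <= m < n * 2 ^ s + 2 ^ s ->
  (graph_dist adj (snd (f (dyadic k n))) (snd (f (dyadic (k + s) m)))
     <= INR (L * s))%R.
Proof.
  revert k n; induction s as [|s IH]; intros k n Hm.
  - simpl in Hm. replace m with n by lia.
    rewrite Nat.add_0_r, graph_dist_refl. apply pos_INR.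
  - cbn [Nat.pow] in Hm.
    assert (Hi : exists i, i < 2 /\
      (2 * n + i) * 2 ^ s <= m < (2 * n + i) * 2 ^ s + 2 ^ s).
    { destruct (le_lt_dec ((2 * n + 1) * 2 ^ s) m);
        [exists 1|exists 0]; nia. }
    destruct Hi as [i [Hi2 Hi]].
    replace (k + S s) with (S k + s) by lia.
    eapply Rle_trans; [apply (graph_dist_triangle adj Hconn) with
      (v := snd (f (dyadic (S k) (2 * n + i))))|].
    replace (L * S s) with (L + L * s) by lia. rewrite plus_INR.
    apply Rplus_le_compat; auto.
Qed.

Context (N : nat)
  (f_fibre : forall y k, exists l : list nat, length l <= N /\
     forall m, (prod_dist T3_dist (graph_dist adj) (f (dyadic k m)) y < 1)%R ->
       In m l).

Lemma f_fibre_word t z k : exists l : list nat, length l <= N /\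
  forall m, tree_word k m = t /\ snd (f (dyadic k m)) = z -> In m l.
Proof.
  destruct (classic (exists u, T3_word u = t)) as [[u Hu]|Hno].
  - destruct (f_fibre (u, z) k) as [l [Hl Hin]].
    exists l. split; [exact Hl|]. intros m [Ht Hz]. apply Hin.
    unfold tree_word in Ht. rewrite <- Hu in Ht. apply T3_word_inj in Ht.
    unfold prod_dist, T3_dist. cbn [fst snd].
    rewrite Ht, Hz, !graph_dist_refl. lra.
  - exists []. split; [simpl; lia|]. intros m [Ht _].
    destruct Hno. eexists. exact Ht.
Qed.

(** Three factors: a number of words depending only on [r], the polynomially many vertices within
    [L * s] allowed by [drift], and at most [N] nodes of the row over each pair. So [D] comes from
    the graph alone. *)
Lemma row_count_near_poly (Hgrowth : polynomial_growth adj) :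
  exists D, forall r, exists M, forall v k n s,
    row_count (near tree_word v r) s k n <= M * S s ^ D.
Proof.
  destruct (growth_nat adj L Hgrowth) as [A [D HA]].
  exists D. intros r. exists (N * A * (S r * length (words r))).
  intros v k n s. rewrite row_count_filter.
  destruct (HA (snd (f (dyadic k n))) s) as [ball [Hball Hin]].
  destruct (cover_union
    (fun tz m => tree_word (k + s) m = fst tz /\
                 snd (f (dyadic (k + s) m)) = snd tz)
    (list_prod (word_ball v r) ball) N) as [l [Hl Hcov]].
  { intros tz _. apply f_fibre_word. }
  rewrite length_prod, length_word_ball in Hl.
  apply (Nat.mul_le_mono_l _ _ (N * (S r * length (words r)))) in Hball.
  apply Nat.le_trans with (length l); [|lia].
  apply NoDup_incl_length; [apply NoDup_filter, seq_NoDup|].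
  intros m Hm. apply filter_In in Hm as [Hm Hnear].
  apply in_seq in Hm. unfold near in Hnear. apply Nat.leb_le in Hnear.
  apply (Hcov (tree_word (k + s) m, snd (f (dyadic (k + s) m))));
    [|split; reflexivity].
  apply in_prod.
  - apply in_word_ball; [exact Hnear|apply T3_word_letters].
  - apply Hin, drift. lia.
Qed.

End Fibres.

Open Scope R_scope.

Theorem theoremA (V : Type) (adj : V -> V -> Prop)
  (Hsym : symmetric_rel adj) (Hconn : connected_graph adj)
  (Hdeg : bounded_degree adj) (Hgrowth : polynomial_growth adj) :
  ~ exists f : H2 -> T3 * V,
      regular hyp_dist (prod_dist T3_dist (graph_dist adj)) f.
Proof.
  intros [f [kappa [Hlip Hfib]]].
  destruct (INR_unbounded (Rmax (kappa * (1 + arcosh (3 / 2)))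
    (kappa * (1 + arcosh (5 / 4))))) as [L HL].
  destruct (INR_unbounded kappa) as [K HK].
  assert (Hedge : forall x x',
    hyp_dist x x' = arcosh (3 / 2) \/ hyp_dist x x' = arcosh (5 / 4) ->
    (word_dist (T3_word (fst (f x))) (T3_word (fst (f x'))) <= L)%nat /\
    graph_dist adj (snd (f x)) (snd (f x')) <= INR L).
  { intros x x' Hx. specialize (Hlip x x'). unfold prod_dist in Hlip.
    pose proof (word_dist_le_T3_dist (fst (f x)) (fst (f x'))).
    pose proof (graph_dist_nonneg T3_adj (fst (f x)) (fst (f x'))).
    pose proof (graph_dist_nonneg adj (snd (f x)) (snd (f x'))).
    pose proof (Rmax_l (kappa * (1 + arcosh (3 / 2)))
      (kappa * (1 + arcosh (5 / 4)))).
    pose proof (Rmax_r (kappa * (1 + arcosh (3 / 2)))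
      (kappa * (1 + arcosh (5 / 4)))).
    unfold T3_dist in *.
    split; [apply INR_le|]; destruct Hx as [Hx|Hx]; rewrite Hx in Hlip; lra. }
  assert (Hvert : forall k n i, (i < 2)%nat ->
    hyp_dist (dyadic k n) (dyadic (S k) (2 * n + i)) = arcosh (3 / 2) \/
    hyp_dist (dyadic k n) (dyadic (S k) (2 * n + i)) = arcosh (5 / 4)).
  { intros k n [|[|i]] Hi; [right|left|lia].
    - rewrite Nat.add_0_r. apply hyp_dist_dyadic_left.
    - apply hyp_dist_dyadic_right. }
  (* A row meets each of the at most [K] unit balls in at most [20] points. *)
  destruct (row_count_near_poly adj Hconn f L) with (N := (20 * K)%nat)
    as [D HD]; auto.
  - intros. apply Hedge, Hvert. assumption.
  - intros y k. destruct (Hfib y) as [centers [Hlen Hc]].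
    destruct (cover_union (fun c m => hyp_dist (dyadic k m) c < 1) centers 20)
      as [l [Hl Hcov]].
    { intros c _. apply dyadic_row_ball. }
    exists l. split.
    + assert (INR (length centers) < INR K) as H%INR_lt by lra. lia.
    + intros m Hm. destruct (Hc _ Hm) as [c [Hin Hcm]]. eauto.
  - apply (no_polynomial_fibres (tree_word f) L) with (D := D).
    + intros k n. apply Hedge. left. apply hyp_dist_dyadic_horizontal.
    + intros k n i Hi. apply Hedge, Hvert, Hi.
    + exact HD.
Qed.
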